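(* Let $n\ge1$ be an integer and let $\boldsymbol\theta=(\theta_1,\ldots,\theta_a)$, $1\le a\le\infty$, with $0\le\theta_i\le1$ and $\sum_i\theta_i=1$. Give each of $n$ cards an infinite vector of labels, all coordinates of all vectors being independent with common distribution $\boldsymbol\theta$ (label $i$ with probability $\theta_i$). Let $T\in\{0,1,2,\ldots\}\cup\{\infty\}$ be the first time $t$ at which the $n$ vectors formed by the first $t$ coordinates of each card's labels are pairwise distinct ($T=\infty$ if there is no such $t$). Then $$\mathrm{SEP}(P_{\boldsymbol\theta}^{*k})=P\{T>k\}\qquad\text{for all integers }k\ge0 .$$
   Context: The $\boldsymbol\theta$-shuffle measure $P_{\boldsymbol\theta}$ on the symmetric group $\mathfrak{S}_n$: start with a deck of $n$ cards in the order $1,\ldots,n$ from top to bottom. Choose $(N_1,\ldots,N_a)$ from the multinomial$(n,\boldsymbol\theta)$ distribution ($n$ balls dropped independently into $a$ boxes according to $\boldsymbol\theta$; $a=\infty$ means countably many boxes). Cut the deck, from the top down, into consecutive packets of sizes $N_1,N_2,\ldots$ (some may be empty). Sequentially drop cards from the bottoms of the packets, choosing at each step packet $i$ with probability proportional to its current size, until all cards are in a single pile. $P_{\boldsymbol\theta}(w)$ is the probability that the resulting deck, read from top to bottom, is $w=w(1)\cdots w(n)$. Convolution powers: $P_{\boldsymbol\theta}^{*0}$ is the point mass at the identity and $P_{\boldsymbol\theta}^{*k}(w)=\sum_{v\in\mathfrak{S}_n}P_{\boldsymbol\theta}(v)P_{\boldsymbol\theta}^{*(k-1)}(v^{-1}w)$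 for $k\ge1$. For a probability measure $Q$ on $\mathfrak{S}_n$, the separation distance to uniform is $\mathrm{SEP}(Q)=\max_{w\in\mathfrak{S}_n}\left(1-n!\,Q(w)\right)$. *)

(* Defs.v *)
From HB Require Import structures.
From mathcomp Require Import all_boot all_order all_algebra all_fingroup.
From mathcomp Require Import finmap all_classical all_reals all_analysis.

Set Implicit Arguments.
Unset Strict Implicit.
Unset Printing Implicit Defensive.

Import Order.TTheory GRing.Theory Num.Theory.

Local Open Scope classical_set_scope.
Local Open Scope ring_scope.

(* Labels (equivalently, boxes or packets) are numbered from 0: they are the   *)
(* i < m when a = Some m, and all natural numbers when a = None, i.e. a = oo.  *)
Definition labels (a : option nat) : set nat :=
  if a is Some m then [set i | (i < m)%N] else setT.

(* theta is only constrained, and only ever used, on labels a. *)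
Definition is_distribution (R : realType) (a : option nat) (theta : nat -> R) :=
  (forall i, labels a i -> 0 <= theta i <= 1) /\
  (\esum_(i in labels a) (theta i)%:E = 1)%E.

(* Probability that dropping the k cards held in the packets ps on top of      *)
(* pile ends with the single pile w. Packets and piles are read from top to    *)
(* bottom. When packet p is nonempty, drop (size p).-1 p is its bottom card    *)
(* (as a one-element sequence) and take (size p).-1 p is what remains of it;   *)
(* an empty packet is chosen with probability 0.                               *)
Fixpoint drop_prob (R : realType) (T : eqType) (k : nat)
    (ps : seq (seq T)) (pile w : seq T) : R :=
  if k is k'.+1 then
    \sum_(i < size ps)
      (let p := nth [::] ps i in
       (size p)%:R / (size (flatten ps))%:R *
       drop_prob R k' (set_nth [::] ps i (take (size p).-1 p))
                 (drop (size p).-1 p ++ pile) w)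
  else (pile == w)%:R.

(* Packet sizes when ball j falls in box b j. Boxes beyond the last occupied   *)
(* one are left out: they give empty packets, which are never chosen.          *)
Definition packet_sizes (n : nat) (b : {ffun 'I_n -> nat}) : seq nat :=
  [seq #|[set j | b j == i]%SET| | i <- iota 0 (\max_j b j).+1].

Definition cut (n : nat) (b : {ffun 'I_n -> nat}) : seq (seq 'I_n) :=
  reshape (packet_sizes b) (enum 'I_n).

(* The theta-shuffle measure. The multinomial(n, theta) packet sizes are       *)
(* realized by n balls dropped independently in the boxes. A permutation w is  *)
(* the deck with card w j in position j, position 0 being the top.             *)
Definition shuffle (R : realType) (n : nat) (a : option nat) (theta : nat -> R)
    (w : 'S_n) : R :=
  fine (\esum_(b in [set b : {ffun 'I_n -> nat} | forall j, labels a (b j)])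
    ((\prod_j theta (b j)) *
     drop_prob R n (cut b) [::] [seq w j | j <- enum 'I_n])%:E)%E.

(* In 'S_n, (s * t) j = t (s j), so that the product of v^-1 and w, in the     *)
(* convention where permutations compose from right to left, is w * v^-1.      *)
Fixpoint convpow (R : realType) (n : nat) (P : 'S_n -> R) (k : nat)
    (w : 'S_n) : R :=
  if k is k'.+1 then \sum_(v : 'S_n) P v * convpow P k' (w * v^-1)%g
  else (w == 1%g)%:R.

(* The identity serves as the default value of the maximum, so that this is    *)
(* the maximum over 'S_n for any Q.                                            *)
Definition sep (R : realType) (n : nat) (Q : 'S_n -> R) : R :=
  \big[Order.max/1 - (n`!)%:R * Q 1%g]_(w : 'S_n) (1 - (n`!)%:R * Q w).

Definition mutually_independent (R : realType) (d d' : measure_display)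
    (Omega : measurableType d) (T : measurableType d') (P : probability Omega R)
    (I : choiceType) (X : I -> {RV P >-> T}) :=
  forall (J : {fset I}) (B : I -> set T), (forall i, measurable (B i)) ->
    (P (\bigcap_(i in [set` J]) (X i @^-1` B i)) =
     \prod_(i <- J) P (X i @^-1` B i))%E.

(* First time t at which the vectors of the first t labels of the n cards are  *)
(* pairwise distinct, L i s being the label of card i at coordinate s; it is   *)
(* +oo, the infimum of the empty set, if there is no such t.                   *)
Definition first_distinct (R : realType) (n : nat) (L : 'I_n -> nat -> nat) :
    \bar R :=
  ereal_inf [set t%:R%:E | t in
    [set t : nat | injective (fun i : 'I_n => mkseq (L i) t)]].

(* Main.v *)
Require Import Defs.
From HB Require Import structures.
From mathcomp Require Import all_boot all_order all_algebra all_fingroup.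
From mathcomp Require Import finmap all_classical all_reals all_analysis.
From mathcomp Require Import ring.

(** Read backwards, the theta-shuffle is a stable sort. Label the positions of
the final deck independently by theta; the card in position j is then the rank
of j when positions are sorted by label, ties being broken by position
([shuffleE]). Writing [standardization] for this rank permutation, k successive
shuffles produce the standardization of the vectors of k labels, compared
lexicographically with the most recent label first and ties broken by position
([convpowE]): composing with one more shuffle amounts to sorting by one more,
most significant, label ([standardization_cons]), and relabelling the positions
by a permutation does not change the law of the labels.

On the event that the n vectors are pairwise distinct, no tie has to be broken,
so that permuting the cards multiplies the standardization by the permutation.
By exchangeability each w has the same share P(distinct) / n! of this event
([separated_uniform]), whence n! Q(w) >= P(distinct), where Q is the k-th
convolution power. If two vectors agree, their positions are sent to values in
the same order, which the order-reversing permutation never does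
([reversal_separated]). So equality holds at the reversal, and the separation
distance is 1 - P(distinct) = P(T > k).

The substance of [shuffleE] is that dropping cards one by one in proportion to
the packet sizes makes all interleavings of the packets equally likely
([drop_probE]). Comparing total masses then shows that the probability of
reaching w from the cut given by the boxes b is the proportion of the
rearrangements of b whose standardization is w ([card_standardization]); since
the multinomial weight of b is invariant under rearrangement, summing over b
gives the law of the standardization. *)

Import Order.TTheory GRing.Theory Num.Theory.

Set Implicit Arguments.
Unset Strict Implicit.
Unset Printing Implicit Defensive.

Local Open Scope classical_set_scope.
Local Open Scope ring_scope.

(** * Dropping cards from packets *)

Lemma drop_prob_suffix (R : realType) (T : eqType) k (ps : seq (seq T)) pile w :
  ~~ suffix pile w -> drop_prob R k ps pile w = 0.
Proof.
elim: k ps pile => [|k IHk] ps pile nsuf /=.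
  by case: eqVneq nsuf => // ->; rewrite suffix_refl.
apply: big1 => i _; rewrite IHk ?mulr0//.
by apply: contra nsuf; apply: suffix_trans; exact: suffix_suffix.
Qed.

(** The packet of a card is recorded by key, so that w interleaves the packets
exactly when the cards of each key occur in w in the order of their packet. *)
Definition interleaves (T : eqType) (key : T -> nat) (ps : seq (seq T))
    (w : seq T) :=
  forall i, [seq x <- w | key x == i] = nth [::] ps i.

(** The bottom card y of an interleaving is the bottom card of its packet;
removing it from both leaves an interleaving of what remains. *)
Lemma interleaves_rcons (T : eqType) (key : T -> nat) (ps : seq (seq T)) w y p :
  nth [::] ps (key y) = rcons p y ->
  interleaves key ps (rcons w y) <->
  interleaves key (set_nth [::] ps (key y) p) w.
Proof.
move=> nthy; split=> sh i; last first.
  rewrite filter_rcons; move: (sh i); rewrite nth_set_nth/= (eq_sym i).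
  by case: eqP => [<- ->|//]; rewrite nthy.
rewrite nth_set_nth/=; move: (sh i); rewrite filter_rcons (eq_sym i).
by case: eqP => [<-|//]; rewrite nthy => /rcons_inj [].
Qed.

Lemma interleaves_last (T : eqType) (key : T -> nat) (ps : seq (seq T)) w y :
  interleaves key ps (rcons w y) ->
  exists p, nth [::] ps (key y) = rcons p y.
Proof.
move=> /(_ (key y)); rewrite filter_rcons eqxx => <-.
by eexists.
Qed.

(** The new top card of the pile must be y, and only the packet of y has it:
a single term of the sum over packets survives. *)
Lemma drop_probS_rcons (R : realType) (T : eqType) (key : T -> nat) k ps p pile
    w y :
  (forall i, all (fun x => key x == i) (nth [::] ps i)) ->
  nth [::] ps (key y) = rcons p y ->
  drop_prob R k.+1 ps pile (rcons w y ++ pile) =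
  (size p).+1%:R / (size (flatten ps))%:R *
  drop_prob R k (set_nth [::] ps (key y) p) (y :: pile) (w ++ y :: pile).
Proof.
move=> keyP nthy /=.
have ylt : (key y < size ps)%N.
  by rewrite ltnNge; apply/negP => /(nth_default [::]); rewrite nthy; case: (p).
rewrite (bigD1 (Ordinal ylt))//= nthy size_rcons/= -cats1 take_size_cat//.
rewrite drop_size_cat// cat_rcons big1 ?addr0// => i /eqP ineq.
case: (lastP (nth [::] ps i)) (keyP i) => [|q x]; first by rewrite !mul0r.
rewrite all_rcons => /andP[/eqP keyx _].
rewrite drop_prob_suffix ?mulr0// size_rcons -cats1/= drop_size_cat//=.
rewrite suffixE size_cat/= addnK drop_size_cat// eqseq_cons negb_and.
apply/orP; left; apply/eqP => yx; case: ineq; apply: val_inj => /=.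
by rewrite yx keyx.
Qed.

Lemma drop_probS0 (R : realType) (T : eqType) (key : T -> nat) k ps pile w y :
  (forall i, all (fun x => key x == i) (nth [::] ps i)) ->
  ~ (exists p, nth [::] ps (key y) = rcons p y) ->
  drop_prob R k.+1 ps pile (rcons w y ++ pile) = 0.
Proof.
move=> keyP nthy /=; apply: big1 => i _.
have := keyP i; move nthx: (nth [::] ps i) => q.
case/lastP: q nthx => [|q x] nthx; first by rewrite !mul0r.
rewrite all_rcons => /andP[/eqP keyx _].
rewrite drop_prob_suffix ?mulr0// size_rcons -cats1/= drop_size_cat//=.
rewrite cat_rcons suffixE size_cat/= addnK drop_size_cat// eqseq_cons negb_and.
apply/orP; left; apply/eqP => yx; case: nthy; exists q.
by rewrite yx keyx nthx.
Qed.

Definition packet_factor (T : eqType) (ps : seq (seq T)) : nat :=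
  \prod_(p <- ps) (size p)`!.

(** All interleavings are equally likely: an interleaving determines the packet
chosen at each step, and the numerators met along the way are, in some order,
1, ..., size p for each packet p, while the denominators are 1, ..., k. *)
Lemma drop_probE (R : realType) (T : eqType) (key : T -> nat) k ps pile w :
  (forall i, all (fun x => key x == i) (nth [::] ps i)) ->
  size w = k -> size (flatten ps) = k ->
  drop_prob R k ps pile (w ++ pile) =
  (`[< interleaves key ps w >])%:R * ((packet_factor ps)%:R / k`!%:R).
Proof.
elim: k ps pile w => [|k IHk] ps pile w keyP sw sf /=.
  have ps0 i : nth [::] ps i = [::].
    have [ilt|ige] := ltnP i (size ps); last by rewrite nth_default.
    case nthx: (nth [::] ps i) => [//|x s].
    have : x \in flatten ps.
      apply/flattenP; exists (nth [::] ps i); first exact: mem_nth.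
      by rewrite nthx mem_head.
    by rewrite (size0nil sf).
  rewrite (size0nil sw) eqxx asboolT; last by move=> i; rewrite ps0.
  rewrite mulr1n mul1r.
  rewrite /packet_factor big1_seq ?divr1// => p /andP[_ /(nthP [::])[i _ <-]].
  by rewrite ps0.
case/lastP: w sw => // w y; rewrite size_rcons => -[sw].
have [[p nthy]|nthy] := pselect (exists p, nth [::] ps (key y) = rcons p y);
    last first.
  rewrite [LHS](drop_probS0 _ _ _ _ keyP nthy) asboolF ?mul0r// => sh.
  by apply: nthy; exact: interleaves_last sh.
rewrite [LHS](drop_probS_rcons _ _ _ _ keyP nthy).
have ylt : (key y < size ps)%N.
  by rewrite ltnNge; apply/negP => /(nth_default [::]); rewrite nthy; case: (p).
have psE : ps = take (key y) ps ++ rcons p y :: drop (key y).+1 ps.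
  by rewrite -nthy -drop_nth// cat_take_drop.
have psE' : set_nth [::] ps (key y) p =
    take (key y) ps ++ p :: drop (key y).+1 ps.
  by rewrite set_nthE ylt.
have sf' : size (flatten (set_nth [::] ps (key y) p)) = k.
  move: sf; rewrite [in X in X -> _]psE psE' !flatten_cat/= !size_cat size_rcons.
  by rewrite addSn addnS => -[].
rewrite IHk//; last first.
  move=> i; rewrite nth_set_nth/=; case: eqP => [->|_]; last exact: keyP.
  by have := keyP (key y); rewrite nthy all_rcons => /andP[].
have -> : `[< interleaves key (set_nth [::] ps (key y) p) w >] =
    `[< interleaves key ps (rcons w y) >].
  by apply: asbool_equiv_eq; split; case: (interleaves_rcons w nthy).
have -> : packet_factor ps =
    ((size p).+1 * packet_factor (set_nth [::] ps (key y) p))%N.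
  rewrite psE' [in LHS]psE /packet_factor !big_cat !big_cons/= size_rcons factS.
  by rewrite -mulnA mulnCA.
rewrite sf factS !natrM.
by field; rewrite nat1r !pnatr_eq0 -lt0n fact_gt0.
Qed.

(** The drops always end with some arrangement of the deck, so their
probabilities sum to 1. *)
Lemma drop_prob_total (R : realType) (n k : nat) (ps : seq (seq 'I_n)) pile :
  size (flatten ps) = k -> perm_eq (flatten ps ++ pile) (enum 'I_n) ->
  \sum_(w : 'S_n) drop_prob R k ps pile [seq w j | j <- enum 'I_n] = 1.
Proof.
elim: k ps pile => [|k IHk] ps pile /=.
  move=> /size0nil -> /= pE.
  have sp : size pile = n by rewrite (perm_size pE) size_enum_ord.
  have pinj : injective (fun j : 'I_n => nth j pile j).
    move=> i j; rewrite (set_nth_default i)  ?sp// => /eqP.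
    rewrite nth_uniq ?sp// ?(perm_uniq pE) ?enum_uniq//.
    by move=> /eqP /val_inj.
  have pileE (w : 'S_n) :
      (pile == [seq w j | j <- enum 'I_n]) = (w == perm pinj).
    apply/eqP/eqP => [pw|->]; last first.
      have [pile0|[x0 _]] : pile = [::] \/ exists x0 : 'I_n, true.
        by case: (pile) => [|x0 ?]; [left|right; exists x0].
      - rewrite [LHS]pile0; apply/esym/size0nil.
        by rewrite size_map size_enum_ord -sp pile0.
      apply: (@eq_from_nth _ x0).
        by rewrite size_map size_enum_ord.
      move=> i; rewrite sp => ilt.
      rewrite (nth_map x0) ?size_enum_ord// permE nth_enum_ord//.
      by apply: set_nth_default; rewrite sp.
    apply/permP => j; rewrite permE pw (nth_map j) ?size_enum_ord//.
    by rewrite nth_ord_enum.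
  by rewrite (bigD1 (perm pinj))//= pileE eqxx big1 ?addr0// => w /negPf wn;
    rewrite pileE wn.
move=> sf pE; rewrite exchange_big/= -[RHS](@divff _ (k.+1%:R : R)) ?pnatr_eq0//.
have kE : k.+1 = (\sum_(i < size ps) size (nth [::] ps i))%N.
  by rewrite -sf size_flatten sumnE big_map (big_nth [::]) big_mkord.
rewrite [X in _ = X%:R / _]kE natr_sum mulr_suml; apply: eq_bigr => i _.
rewrite -mulr_sumr sf.
move nthx: (nth [::] ps i) => p.
case/lastP: p nthx => [|p x] nthx; first by rewrite !mul0r.
rewrite size_rcons/= -cats1 take_size_cat// drop_size_cat//.
have psE : ps = take i ps ++ rcons p x :: drop i.+1 ps.
  by rewrite -nthx -drop_nth// cat_take_drop.
have psE' : set_nth [::] ps i p = take i ps ++ p :: drop i.+1 ps.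
  by rewrite set_nthE ltn_ord.
rewrite IHk ?mulr1//.
  move: sf; rewrite [in X in X -> _]psE psE' !flatten_cat/= !size_cat size_rcons.
  by rewrite addSn addnS => -[].
apply: perm_trans pE; rewrite psE' [in X in perm_eq _ X]psE !flatten_cat/=.
rewrite -!catA perm_cat2l -cats1 -!catA perm_cat2l.
by rewrite -[x :: pile]cat1s perm_catCA.
Qed.

(** * Standardization *)

(** The head of h, which is the most recent vector of labels, is the most
significant, and the position is the least significant. *)
Fixpoint lexlt (n : nat) (h : seq {ffun 'I_n -> nat}) (i j : 'I_n) : bool :=
  if h is c :: h' then (c i < c j)%N || ((c i == c j) && lexlt h' i j)
  else (i < j)%N.

Lemma lexlt_irr n (h : seq {ffun 'I_n -> nat}) : irreflexive (lexlt h).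
Proof. by elim: h => [|c h IHh] i /=; rewrite ltnn ?IHh ?andbF. Qed.

Lemma lexlt_trans n (h : seq {ffun 'I_n -> nat}) : transitive (lexlt h).
Proof.
elim: h => [|c h IHh] j i k /=; first exact: ltn_trans.
case/orP => [ij|/andP[/eqP-> ij]].
  by case/orP => [/(ltn_trans ij)->|/andP[/eqP<- _]]; rewrite ?ij.
by case/orP => [->|/andP[->/=/(IHh _ _ _ ij)->]]; rewrite ?orbT.
Qed.

Lemma lexlt_total n (h : seq {ffun 'I_n -> nat}) i j :
  i != j -> lexlt h i j || lexlt h j i.
Proof.
move=> ij; elim: h => [|c h IHh] /=; first by rewrite -neq_ltn.
by case: ltngtP => //=; rewrite IHh.
Qed.

Lemma sorted_enum_ord n : sorted (fun i j : 'I_n => (i < j)%N) (enum 'I_n).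
Proof.
by have := iota_ltn_sorted 0 n; rewrite -val_enum_ord sorted_map.
Qed.

Definition lexrank n (h : seq {ffun 'I_n -> nat}) (j : 'I_n) : nat :=
  #|[set i | lexlt h i j]%SET|.

Lemma lexrank_mono n (h : seq {ffun 'I_n -> nat}) i j :
  (lexrank h i < lexrank h j)%N = lexlt h i j.
Proof.
have homo i' j' : lexlt h i' j' -> (lexrank h i' < lexrank h j')%N.
  move=> ij; apply: proper_card; apply/properP; split; last first.
    by exists i'; rewrite !inE ?lexlt_irr.
  by apply/fintype.subsetP => k; rewrite !inE => /lexlt_trans; exact.
apply/idP/idP; last exact: homo.
have [->|/(lexlt_total h)/orP[//|/homo]] := eqVneq i j; first by rewrite ltnn.
by move=> /ltnW; rewrite leqNgt => /negPf ->.
Qed.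

Lemma lexrank_lt n (h : seq {ffun 'I_n -> nat}) j : (lexrank h j < n)%N.
Proof.
rewrite -[X in (_ < X)%N]card_ord -cardsT; apply: proper_card.
by apply/properP; split; [exact: finset.subsetT|exists j; rewrite !inE ?lexlt_irr].
Qed.

Lemma lexrank_inj n (h : seq {ffun 'I_n -> nat}) :
  injective (fun j => Ordinal (lexrank_lt h j)).
Proof.
move=> i j /(congr1 val)/= ij; apply/eqP/negP => /negP/(lexlt_total h).
by rewrite -!lexrank_mono ij ltnn.
Qed.

Definition standardization n (h : seq {ffun 'I_n -> nat}) : 'S_n :=
  perm (@lexrank_inj n h).

Lemma standardizationE n (h : seq {ffun 'I_n -> nat}) i j :
  (standardization h i < standardization h j)%N = lexlt h i j.
Proof. by rewrite !permE/= lexrank_mono. Qed.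

(** A permutation w with this property is determined by it, because the inverse
of w lists the positions in increasing lexicographic order. *)
Lemma standardizationP n (h : seq {ffun 'I_n -> nat}) (w : 'S_n) :
  (forall i j, (w i < w j)%N = lexlt h i j) <-> standardization h = w.
Proof.
split=> [wE|<- i j]; last exact: standardizationE.
have sorted_inv (v : 'S_n) : (forall i j, (v i < v j)%N = lexlt h i j) ->
    sorted (lexlt h) [seq v^-1%g x | x <- enum 'I_n].
  move=> vE; rewrite sorted_map.
  rewrite (@eq_sorted _ _ (fun i j : 'I_n => (i < j)%N)) ?sorted_enum_ord//.
  by move=> x y /=; rewrite -vE !permKV.
have : [seq (standardization h)^-1%g x | x <- enum 'I_n] =
    [seq w^-1%g x | x <- enum 'I_n].
  apply: (irr_sorted_eq (@lexlt_trans _ h) (@lexlt_irr _ h)).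
  - by apply: sorted_inv; exact: standardizationE.
  - exact: sorted_inv.
  - move=> x; transitivity true; last apply/esym.
      by rewrite -[x](permK (standardization h)) map_f ?mem_enum.
    by rewrite -[x](permK w) map_f ?mem_enum.
move/eq_in_map => invE; apply: invg_inj; apply/permP => x.
by apply: invE; rewrite mem_enum.
Qed.

(** * The cut deck and the rearrangements of the boxes *)

(** Cutting a list that is sorted by key into its level sets, in increasing
order of key, loses nothing. *)
Lemma flatten_levels (T : eqType) (key : T -> nat) (s : seq T) m :
  sorted (fun x y => key x <= key y)%N s ->
  flatten [seq [seq x <- s | key x == i] | i <- iota 0 m] =
  [seq x <- s | (key x < m)%N].
Proof.
have ktrans : transitive (fun x y => key x <= key y)%N.
  by move=> y x z; exact: leq_trans.
move=> ss; elim: m => [|m IHm].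
  by rewrite -[LHS](filter_pred0 s); apply: eq_filter.
rewrite -addn1 iotaD map_cat flatten_cat IHm/= cats0 add0n.
rewrite addn1 /=.
elim: s ss {IHm} => //= x s IHs; rewrite (path_sortedE ktrans) => /andP[xs ss].
rewrite ltnS -IHs//; case: ltngtP => //= kx.
rewrite (_ : [seq y <- s | (key y < m)%N] = [::])//.
apply/eqP; rewrite -(negbK (_ == _)) -has_filter -all_predC.
by apply: sub_all xs => y /=; rewrite kx -leqNgt.
Qed.

(** The values of b listed in increasing order: this is the packet in which the
cut places card x. *)
Definition sorted_label n (b : {ffun 'I_n -> nat}) (x : 'I_n) : nat :=
  b ((standardization [:: b])^-1%g x).

Section CutCount.
Variables (n : nat) (b : {ffun 'I_n -> nat}).

Local Notation p := (standardization [:: b]).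
Local Notation key := (sorted_label b).

Lemma sorted_label_mono (x y : 'I_n) : (x <= y)%N -> (key x <= key y)%N.
Proof.
rewrite leq_eqVlt => /orP[/eqP/val_inj->//|].
rewrite -{1}(permKV p x) -{1}(permKV p y) standardizationE /=.
by case/orP => [/ltnW//|/andP[/eqP xy _]]; rewrite /sorted_label xy.
Qed.

(** Sorting b preserves its level sets up to a permutation, hence the sizes of
the packets. *)
Lemma card_level i : size [seq x <- enum 'I_n | key x == i] =
  #|[set j | b j == i]%SET|.
Proof.
rewrite -(card_imset _ (@perm_inj _ p)) cardE.
apply: perm_size; apply: uniq_perm.
- by rewrite filter_uniq// enum_uniq.
- exact: enum_uniq.
- move=> x; rewrite mem_filter !mem_enum andbT; apply/eqP/imsetP.
    by move=> kx; exists (p^-1%g x); rewrite ?permKV// inE -kx.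
  by case=> y; rewrite inE => /eqP <- ->; rewrite /sorted_label permK.
Qed.

Lemma sorted_label_lt x : (key x < (\max_j b j)%N.+1)%N.
Proof. by rewrite ltnS; exact: leq_bigmax. Qed.

Lemma cutE : Defs.cut b =
  [seq [seq x <- enum 'I_n | key x == i] | i <- iota 0 (\max_j b j)%N.+1].
Proof.
rewrite /Defs.cut; set ls := (X in _ = X).
have -> : packet_sizes b = shape ls.
  by rewrite /shape -map_comp; apply: eq_map => i /=; rewrite card_level.
rewrite -[RHS]flattenK flatten_levels.
  by rewrite (eq_filter (a2 := xpredT)) ?filter_predT// => x; rewrite sorted_label_lt.
by apply: sub_sorted (sorted_enum_ord n) => x y /ltnW/sorted_label_mono.
Qed.

Lemma nth_cut i : nth [::] (Defs.cut b) i = [seq x <- enum 'I_n | key x == i].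
Proof.
rewrite cutE; have [im|mi] := ltnP i (\max_j b j)%N.+1.
  by rewrite (nth_map 0%N) ?size_iota// nth_iota.
rewrite nth_default ?size_map ?size_iota//; apply/esym/eqP.
rewrite -(negbK (_ == _)) -has_filter -all_predC; apply/allP => x _ /=.
by apply: contraTneq mi => <-; rewrite -ltnNge sorted_label_lt.
Qed.

Lemma flatten_cut : flatten (Defs.cut b) = enum 'I_n.
Proof.
rewrite cutE flatten_levels.
  by rewrite (eq_filter (a2 := xpredT)) ?filter_predT// => x; rewrite sorted_label_lt.
by apply: sub_sorted (sorted_enum_ord n) => x y /ltnW/sorted_label_mono.
Qed.

Lemma interleaves_cut (w : 'S_n) :
  interleaves key (Defs.cut b) [seq w j | j <- enum 'I_n] <->
  (forall i j : 'I_n, (i < j)%N -> key (w i) = key (w j) -> (w i < w j)%N).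
Proof.
have ltr : transitive (fun i j : 'I_n => (i < j)%N) by move=> ? ? ?; exact: ltn_trans.
have ltirr : irreflexive (fun i j : 'I_n => (i < j)%N) by move=> ?; exact: ltnn.
split=> [sh i j ij kij|winc l].
  (* The pair w i, w j is a sublist of its level in w, which is the
     increasing list of the cards of that packet. *)
  have subs : subseq [:: i; j] (enum 'I_n).
    have <- : [seq x <- enum 'I_n | x \in [:: i; j]] = [:: i; j].
      apply: (irr_sorted_eq ltr ltirr) => /=; last first.
      - by move=> x; rewrite mem_filter mem_enum andbT.
      - by rewrite ij.
      - exact: sorted_filter (sorted_enum_ord n).
    exact: filter_subseq.
  have : subseq [:: w i; w j] [seq x <- enum 'I_n | key x == key (w i)].
    rewrite -nth_cut -sh.
    have -> : [:: w i; w j] = [seq x <- map w [:: i; j] | key x == key (w i)].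
      by rewrite /= eqxx -kij eqxx.
    rewrite subseq_filter filter_all.
    by apply: (subseq_trans (filter_subseq _ _)); exact: map_subseq.
  move/(subseq_sorted ltr) => /(_ (sorted_filter ltr _ (sorted_enum_ord n))).
  by rewrite /= andbT.
rewrite nth_cut; apply: (irr_sorted_eq ltr ltirr).
- rewrite filter_map sorted_map.
  apply: (@sub_in_sorted _ (fun j => key (w j) == l)
    (fun i j : 'I_n => (i < j)%N)); last first.
  + exact: sorted_filter (sorted_enum_ord n).
  + exact: filter_all.
  + by move=> i j /eqP ki /eqP kj ij /=; apply: winc => //; rewrite ki.
- exact: sorted_filter (sorted_enum_ord n).
- move=> x; rewrite mem_filter [RHS]mem_filter mem_enum.
  by rewrite -[X in X \in map _ _](permKV w x) map_f ?mem_enum.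
Qed.

(** A rearrangement of b with standardization w has, in position w^-1 x, the
value of rank x among the sorted values of b; ties are then broken by position
exactly when w keeps the order inside each packet. *)
Lemma standardization_reorder (s w : 'S_n) :
  standardization [:: [ffun i => b (s i)]] = w <->
  (forall i j : 'I_n, (i < j)%N -> key (w i) = key (w j) -> (w i < w j)%N) /\
  (forall i, b (s i) = key (w i)).
Proof.
rewrite -standardizationP /=; split=> [wE|[winc bE] i j].
  have bE i : b (s i) = key (w i).
    have : [seq b (s (w^-1%g x)) | x <- enum 'I_n] = [seq key x | x <- enum 'I_n].
      apply: (sorted_eq leq_trans anti_leq).
      - rewrite sorted_map; apply: sub_sorted (sorted_enum_ord n) => x y /=.
        by rewrite -{1}(permKV w x) -{1}(permKV w y) wE !ffunE
          => /orP[/ltnW|/andP[/eqP->]].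
      - rewrite sorted_map.
        by apply: sub_sorted (sorted_enum_ord n) => x y /ltnW/sorted_label_mono.
      - have permE (v : 'S_n) :
            perm_eq [seq b (v x) | x <- enum 'I_n] [seq b x | x <- enum 'I_n].
          rewrite (map_comp b v); apply: perm_map.
          apply: uniq_perm; rewrite ?enum_uniq ?(map_inj_uniq perm_inj) ?enum_uniq//.
          by move=> x; rewrite mem_enum -[x](permKV v) map_f ?mem_enum.
        apply: (@perm_trans _ [seq b x | x <- enum 'I_n]); last first.
          by rewrite perm_sym; exact: permE.
        rewrite (_ : [seq _ | x <- _] =
          [seq b ((w^-1 * s)%g x) | x <- enum 'I_n]) ?permE//.
        by apply: eq_map => x; rewrite permM.
    move/eq_in_map/(_ (w i)); rewrite mem_enum permK; exact.
  split=> // i j ij kij.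
  by rewrite wE !ffunE !bE kij eqxx ij orbT.
rewrite !ffunE !bE.
have [kij|kij|kij]/= := ltngtP (key (w i)) (key (w j)).
- by rewrite ltnNge; apply/negP => /sorted_label_mono; rewrite leqNgt kij.
- apply/negbTE; rewrite -leqNgt; apply: contraTT kij.
  by rewrite -leqNgt -ltnNge => /ltnW/sorted_label_mono.
- have [ij|ji|/val_inj ->] := ltngtP i j; last by rewrite ltnn.
  + exact: winc.
  + by apply/negbTE; rewrite -leqNgt ltnW// winc.
Qed.

(** The number of such rearrangements is the same for all interleavings w:
composition with w carries it to the number for the identity. *)
Lemma card_reorder (w : 'S_n) :
  #|[set s : 'S_n | standardization [:: [ffun i => b (s i)]] == w]%SET| =
  (`[< interleaves key (Defs.cut b) [seq w j | j <- enum 'I_n] >] *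
   #|[set s : 'S_n | [forall i, b (s i) == key i]]%SET|)%N.
Proof.
have -> : `[< interleaves key (Defs.cut b) [seq w j | j <- enum 'I_n] >] =
    `[< forall i j : 'I_n, (i < j)%N -> key (w i) = key (w j) -> (w i < w j)%N >].
  exact/asbool_equiv_eq/interleaves_cut.
case: asboolP => [winc|wninc]; rewrite ?(mul1n, mul0n); last first.
  apply/eqP; rewrite cards_eq0; apply/eqP/setP => s; rewrite !inE.
  by apply/negP => /eqP/standardization_reorder[].
rewrite -[RHS](card_imset _ (mulgI w)); apply: eq_card => s; rewrite inE.
apply/eqP/imsetP => [/standardization_reorder[_ bE]|[t]].
  exists (w^-1 * s)%g; last by rewrite mulKVg.
  by rewrite inE; apply/forallP => i; rewrite permM bE permKV.
rewrite inE => /forallP bE ->; apply/standardization_reorder; split=> // i.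
by rewrite permM (eqP (bE _)).
Qed.

(** Both sides are constant on the interleavings and vanish elsewhere, so it is
enough that they have the same sum n! over w. *)
Lemma card_standardization (R : realType) (w : 'S_n) :
  #|[set s : 'S_n | standardization [:: [ffun i => b (s i)]] == w]%SET|%:R =
  n`!%:R * drop_prob R n (Defs.cut b) [::] [seq w j | j <- enum 'I_n].
Proof.
pose I (v : 'S_n) := `[< interleaves key (Defs.cut b) [seq v j | j <- enum 'I_n] >].
(* The drop probability of an interleaving, and its number of rearrangements. *)
pose C : R := (packet_factor (Defs.cut b))%:R / n`!%:R.
pose C' := #|[set s : 'S_n | [forall i, b (s i) == key i]]%SET|.
have dE (v : 'S_n) : drop_prob R n (Defs.cut b) [::] [seq v j | j <- enum 'I_n] =
    (I v)%:R * C.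
  rewrite -[X in drop_prob _ _ _ _ X]cats0 (@drop_probE _ _ key)//.
  - by move=> i; rewrite nth_cut filter_all.
  - by rewrite size_map size_enum_ord.
  - by rewrite flatten_cut size_enum_ord.
have total : (\sum_(v : 'S_n) (I v)%:R) * C = 1.
  rewrite -[RHS](@drop_prob_total R n n (Defs.cut b) [::]).
  - by rewrite mulr_suml; apply: eq_bigr => v _; rewrite dE.
  - by rewrite flatten_cut size_enum_ord.
  - by rewrite flatten_cut cats0.
have total' : n`!%:R = (\sum_(v : 'S_n) (I v)%:R) * C'%:R :> R.
  rewrite -card_Sn -cardsT -sum1_card natr_sum.
  rewrite (partition_big (fun s : 'S_n => standardization [:: [ffun i => b (s i)]])
    xpredT)//= mulr_suml.
  apply: eq_bigr => v _; rewrite -natrM -card_reorder -natr_sum sum1_card.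
  congr (_%:R); apply: eq_card => s; rewrite [RHS]inE unfold_in.
  by rewrite finset.in_setT.
rewrite card_reorder dE total' -/C' natrM -/(I w).
have := congr1 (fun x => x * ((I w)%:R * C'%:R)) total.
by rewrite mul1r => <-; ring.
Qed.

End CutCount.

(** * Countable sums and countably valued random variables *)

Lemma ge0_esumZl (R : realType) (T : choiceType) (S : set T) (a : T -> \bar R)
    (r : R) :
  0 <= r -> (forall x, (0 <= a x)%E) ->
  (\esum_(x in S) (r%:E * a x) = r%:E * \esum_(x in S) a x)%E.
Proof.
move=> r0 a0; rewrite /esum -ereal_supZl//; last first.
  apply/set0P; exists (\sum_(x \in set0) a x)%E, set0 => //.
  by split => //; exact: sub0set.
congr ereal_sup; rewrite [RHS]image_comp; apply/seteqP; split=> y.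
  by move=> [A AS <-]; exists A => //=; rewrite ge0_mule_fsumr.
by move=> [A AS <-]; exists A => //=; rewrite ge0_mule_fsumr.
Qed.

Lemma esum_finType (R : realType) (T : finType) (a : T -> \bar R) :
  (forall x, (0 <= a x)%E) -> (\esum_(x in [set: T]) a x = \sum_x a x)%E.
Proof.
move=> a0; rewrite esum_fset//; last exact: finite_finset.
rewrite [RHS]fsbig_seq ?index_enum_uniq//.
by apply: eq_fsbigl; apply/seteqP; split=> x //= _; exact: mem_index_enum.
Qed.

Section CountablyValued.
Variables (R : realType) (d : measure_display) (Omega : measurableType d).
Variables (P : probability Omega R) (C : countType) (F : Omega -> C).
Hypothesis mF : forall c, measurable (F @^-1` [set c]).

Lemma measurable_countably_valued (A : set C) : measurable (F @^-1` A).
Proof.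
have -> : F @^-1` A = \bigcup_(c in A) F @^-1` [set c].
  by apply/seteqP; split=> [w Aw|w [c Ac /= ->]] //;  by exists (F w).
rewrite bigcup_mkcond.
apply: countable_bigcupT_measurable => [|c]; first exact: countableP.
by case: ifP => // _; exact: mF.
Qed.

Lemma probability_fibers (A : set C) (E : set Omega) : measurable E ->
  P (F @^-1` A `&` E) = (\esum_(c in A) P (F @^-1` [set c] `&` E))%E.
Proof.
move=> mE.
pose G (i : nat) :=
  if choice.unpickle i is Some c then F @^-1` [set c] `&` E else set0.
have -> : F @^-1` A `&` E = \bigcup_(i in choice.pickle @` A) G i.
  rewrite bigcup_image; apply/seteqP; split=> [w [Aw Ew]|w [c Ac]].
    by exists (F w) => //; rewrite /G choice.pickleK.
  by rewrite /G choice.pickleK => -[/= Fw Ew]; rewrite -Fw in Ac.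
rewrite measure_bigcup; last 2 first.
- by move=> i [c _ <-]; rewrite /G choice.pickleK; exact: measurableI.
- move=> _ _ [c _ <-] [c' _ <-]; rewrite /G !choice.pickleK.
  by move=> [w [[/= <- _] [/= <- _]]].
rewrite nneseries_esum// set_mem_set esum_image.
  by apply: eq_esum => c _; rewrite /G choice.pickleK.
by move=> c c' _ _; exact: (pcan_inj choice.pickleK).
Qed.

Lemma probability_fibersT (A : set C) :
  P (F @^-1` A) = (\esum_(c in A) P (F @^-1` [set c]))%E.
Proof.
rewrite -[F @^-1` A]setIT probability_fibers//.
by apply: eq_esum => c _; rewrite setIT.
Qed.

(** The point masses are summed after reindexing the fibers by g. *)
Lemma probability_invariant (g g' : C -> C) (A : set C) :
  cancel g g' -> cancel g' g ->
  (forall c, P (F @^-1` [set (g c)]) = P (F @^-1` [set c])) ->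
  P (F @^-1` (g @^-1` A)) = P (F @^-1` A).
Proof.
move=> gK g'K law; rewrite !probability_fibersT.
rewrite (@reindex_esum _ _ _ (g @^-1` A) A g).
  by apply: eq_esum => c _; rewrite law.
split=> //; first by move=> c c' _ _; exact: (can_inj gK).
by move=> c Ac; exists (g' c); rewrite /= g'K.
Qed.

End CountablyValued.

(** Both events are countable unions of fibers, so the product rule on fibers
can be summed over each of them in turn. *)
Lemma independent_preimages (R : realType) (d : measure_display)
    (Omega : measurableType d) (P : probability Omega R) (C D : countType)
    (F : Omega -> C) (G : Omega -> D) (A : set C) (B : set D) :
  (forall c, measurable (F @^-1` [set c])) ->
  (forall c, measurable (G @^-1` [set c])) ->
  (forall c e, P (F @^-1` [set c] `&` G @^-1` [set e]) =
     (P (F @^-1` [set c]) * P (G @^-1` [set e]))%E) ->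
  P (F @^-1` A `&` G @^-1` B) = (P (F @^-1` A) * P (G @^-1` B))%E.
Proof.
move=> mF mG FG.
have mFA := measurable_countably_valued mF A.
have mGB := measurable_countably_valued mG B.
have finP (S : set Omega) : measurable S -> P S = (fine (P S))%:E.
  by move=> mS; rewrite fineK// fin_num_measure.
have fine0 (S : set Omega) : 0 <= fine (P S) by exact/fine_ge0/measure_ge0.
rewrite probability_fibers// muleC.
rewrite (finP _ mGB) (probability_fibersT _ mF A) -ge0_esumZl//.
apply: eq_esum => c _; rewrite -finP// setIC probability_fibers//.
rewrite muleC (finP _ (mF c)) (probability_fibersT _ mG B) -ge0_esumZl//.
by apply: eq_esum => e _; rewrite setIC FG -finP.
Qed.

(** * The label process *)

Definition permute_cards n (u : 'S_n) (c : {ffun 'I_n -> nat}) :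
  {ffun 'I_n -> nat} := [ffun i => c (u i)].

Lemma permute_cardsK n (u : 'S_n) :
  cancel (permute_cards u) (permute_cards u^-1%g).
Proof. by move=> c; apply/ffunP => i; rewrite !ffunE permKV. Qed.

Lemma permute_cardsKV n (u : 'S_n) :
  cancel (permute_cards u^-1%g) (permute_cards u).
Proof. by move=> c; apply/ffunP => i; rewrite !ffunE permK. Qed.

(** Sorting by c :: h can be done in two passes, as in a radix sort: a sort by h,
followed by a stable sort by c of the list obtained. *)
Lemma standardization_cons n (c : {ffun 'I_n -> nat}) h :
  let u := standardization h in
  standardization (c :: h) =
  (u * standardization [:: permute_cards u^-1%g c])%g.
Proof.
move=> u; apply/standardizationP => i j /=.
by rewrite !permM standardizationE /= !ffunE !permK standardizationE.
Qed.

Section LabelProcess.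
Variables (R : realType) (n : nat) (a : option nat) (theta : nat -> R).
Hypothesis theta_distr : is_distribution a theta.
Variables (d : measure_display) (Omega : measurableType d).
Variables (P : probability Omega R) (X : 'I_n * nat -> {RV P >-> nat}).
Hypothesis X_indep : mutually_independent X.
Hypothesis X_law : forall (i : 'I_n) (s l : nat), labels a l ->
  P [set omega | X (i, s) omega = l] = (theta l)%:E.

Definition label_mass (l : nat) : R := if l \in labels a then theta l else 0.

Lemma label_mass_ge0 l : 0 <= label_mass l.
Proof.
rewrite /label_mass; case: ifPn => // /set_mem al.
by have [/(_ l al)/andP[]] := theta_distr.
Qed.

Lemma measurable_label p (A : set nat) : measurable (X p @^-1` A).
Proof. by rewrite -[X in measurable X]setTI; exact: measurable_funP. Qed.

(** The law is prescribed on the labels only, but these already carry the whole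
mass. *)
Lemma label_law p l : P (X p @^-1` [set l]) = (label_mass l)%:E.
Proof.
case: p => i s; rewrite /label_mass; case: ifPn => [/set_mem al|/negP al].
  exact: X_law.
have mX c : measurable (X (i, s) @^-1` [set c]) by exact: measurable_label.
have X1 : P (X (i, s) @^-1` labels a) = 1%E.
  rewrite (probability_fibersT P mX) -(theta_distr.2).
  by apply: eq_esum => c cl; exact: X_law.
apply/eqP; rewrite eq_le measure_ge0 andbT.
have PC : P (X (i, s) @^-1` (~` labels a)) = 0%E.
  by rewrite preimage_setC probability_setC ?X1 ?subee//; exact: measurable_label.
apply: (@le_trans _ _ (P (X (i, s) @^-1` (~` labels a)))); last by rewrite PC.
apply: le_measure; rewrite ?inE; do ?exact: measurable_label.
by move=> w /= ->; move: al; rewrite inE.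
Qed.

Lemma joint_label_law (J : seq ('I_n * nat)) (L : 'I_n * nat -> nat) : uniq J ->
  P (\bigcap_(p in [set` J]) X p @^-1` [set L p]) =
  (\prod_(p <- J) label_mass (L p))%:E.
Proof.
move=> uJ; pose JF := [fset p in J]%fset.
have -> : [set` J] = [set` JF].
  by apply/seteqP; split=> p /=; rewrite !inE.
rewrite (X_indep JF (B := fun p => [set L p]))//.
rewrite (perm_big J); last first.
  by apply: uniq_perm => [||p]; rewrite ?fset_uniq// !inE.
rewrite -prodEFin; apply: eq_bigr => p _; exact: label_law.
Qed.

Definition labels_at (s : nat) (w : Omega) : {ffun 'I_n -> nat} :=
  [ffun i => X (i, s) w].

(** The most recent labels come first, to match the order in which lexlt reads
them. *)
Fixpoint history (k : nat) (w : Omega) : seq {ffun 'I_n -> nat} :=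
  if k is k'.+1 then labels_at k' w :: history k' w else [::].

Lemma size_history k w : size (history k w) = k.
Proof. by elim: k => //= k ->. Qed.

Definition labels_mass (c : {ffun 'I_n -> nat}) : R := \prod_i label_mass (c i).

Lemma labels_mass_ge0 c : 0 <= labels_mass c.
Proof. by apply: prodr_ge0 => i _; exact: label_mass_ge0. Qed.

Lemma labels_mass_permute u c : labels_mass (permute_cards u c) = labels_mass c.
Proof.
rewrite /labels_mass [RHS](reindex_inj (@perm_inj _ u)).
by apply: eq_bigr => i _; rewrite ffunE.
Qed.

Lemma measurable_labels_at s c : measurable (labels_at s @^-1` [set c]).
Proof.
have -> : labels_at s @^-1` [set c] =
    \bigcap_(i in [set: 'I_n]) X (i, s) @^-1` [set c i].
  apply/seteqP; split=> w /= => [<- i _|Xc]; first by rewrite /= ffunE.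
  by apply/ffunP => i; rewrite ffunE; exact: Xc.
by apply: fin_bigcap_measurable => // i _; exact: measurable_label.
Qed.

Lemma measurable_history k h : measurable (history k @^-1` [set h]).
Proof.
elim: k h => [|k IHk] h.
  have [->|/eqP h0] := eqVneq h [::].
    by rewrite (_ : _ @^-1` _ = setT)//; apply/seteqP; split.
  by rewrite (_ : _ @^-1` _ = set0)// -subset0 => w /= /esym.
case: h => [|c h]; first by rewrite (_ : _ @^-1` _ = set0)// -subset0 => w.
rewrite (_ : _ @^-1` _ =
  labels_at k @^-1` [set c] `&` history k @^-1` [set h]).
  exact: measurableI (measurable_labels_at _ _) (IHk h).
by apply/seteqP; split=> w /= [-> ->].
Qed.

Lemma labels_at_law s c : P (labels_at s @^-1` [set c]) = (labels_mass c)%:E.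
Proof.
have uJ : uniq [seq (i, s) | i <- enum 'I_n].
  by rewrite map_inj_uniq ?enum_uniq// => i j [].
rewrite -[RHS](_ : (\prod_(p <- [seq (i, s) | i <- enum 'I_n])
    label_mass (c p.1))%:E = _); last by rewrite big_map big_enum.
rewrite -(joint_label_law (fun p => c p.1) uJ); congr (P _).
apply/seteqP; split=> w /= => [<- _ /mapP[i _ ->]|Xc]; first by rewrite /= ffunE.
by apply/ffunP => i; rewrite ffunE; apply: (Xc (i, s)); rewrite /= map_f ?mem_enum.
Qed.

(** The labels of time s sit at index s of the reversed history; c0 is only a
default value for nth. *)
Lemma historyP (c0 : {ffun 'I_n -> nat}) h w :
  history (size h) w = h <->
  (forall s i, (s < size h)%N -> X (i, s) w = nth c0 (rev h) s i).
Proof.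
elim: h => [|c h IHh]//=; split=> [[<- hE] s i|XE].
  rewrite ltnS leq_eqVlt rev_cons nth_rcons size_rev.
  move/IHh: hE => hE; have [->|sh] := eqVneq s (size h).
    by rewrite ltnn /= ffunE.
  by move=> /= slt; rewrite slt hE.
have cE : labels_at (size h) w = c.
  apply/ffunP => i; rewrite ffunE XE// rev_cons nth_rcons size_rev.
  by rewrite ltnn eqxx.
have hE : history (size h) w = h.
  apply/IHh => s i sh; rewrite XE 1?ltnW// rev_cons nth_rcons size_rev.
  by rewrite sh.
by rewrite cE hE.
Qed.

Lemma history_law k h : P (history k @^-1` [set h]) =
  (if size h == k then (\prod_(c <- h) labels_mass c)%:E else 0)%E.
Proof.
case: eqP => [<-|hk]; last first.
  rewrite (_ : _ @^-1` _ = set0) ?measure0// -subset0 => w /= hE.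
  by apply: hk; rewrite -hE size_history.
pose c0 : {ffun 'I_n -> nat} := [ffun => 0%N].
pose J := [seq (i, s) | s <- iota 0 (size h), i <- enum 'I_n].
pose L (p : 'I_n * nat) := nth c0 (rev h) p.2 p.1.
have uJ : uniq J.
  apply: allpairs_uniq; rewrite ?iota_uniq ?enum_uniq//.
  by move=> [s i] [s' i'] _ _ /= [-> ->].
have -> : \prod_(c <- h) labels_mass c = \prod_(p <- J) label_mass (L p).
  rewrite big_allpairs_dep /= -(perm_big _ (permEl (perm_rev h))).
  rewrite (big_nth c0) size_rev /index_iota subn0; apply: eq_bigr => s _.
  by rewrite /labels_mass big_enum.
rewrite -(joint_label_law L uJ); congr (P _).
apply/seteqP; split=> w /=.
  move=> /(historyP c0) hE _ /allpairsP[[s i] [/= sh _ ->]] /=.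
  by apply: hE; move: sh; rewrite mem_iota.
move=> XE; apply/(historyP c0) => s i sh; apply: (XE (i, s)) => /=.
by apply/allpairsP; exists (s, i); rewrite mem_iota mem_enum.
Qed.

Lemma history_labels_indep k A B :
  P (history k @^-1` A `&` labels_at k @^-1` B) =
  (P (history k @^-1` A) * P (labels_at k @^-1` B))%E.
Proof.
apply: independent_preimages; [exact: measurable_history|
  exact: measurable_labels_at|move=> h c].
rewrite -[X in P X](_ : history k.+1 @^-1` [set c :: h] = _); last first.
  by apply/seteqP; split=> w /= [-> ->].
rewrite !history_law labels_at_law /= eqSS; case: eqP => _; last by rewrite mul0e.
by rewrite big_cons mulrC EFinM.
Qed.

Lemma labels_at_exchangeable s u A :
  P (labels_at s @^-1` (permute_cards u @^-1` A)) = P (labels_at s @^-1` A).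
Proof.
apply: (probability_invariant (@measurable_labels_at s) A
  (permute_cardsK u) (permute_cardsKV u)) => c.
by rewrite !labels_at_law labels_mass_permute.
Qed.

Lemma history_exchangeable k u A :
  P (history k @^-1` (map (permute_cards u) @^-1` A)) = P (history k @^-1` A).
Proof.
apply: (probability_invariant (@measurable_history k) A
  (mapK (permute_cardsK u)) (mapK (permute_cardsKV u))) => h.
rewrite !history_law size_map; case: eqP => // _; rewrite big_map.
by under eq_bigr do rewrite labels_mass_permute.
Qed.

(** Averaging over the rearrangements of b leaves the weight of b unchanged and,
by card_standardization, turns the probability of dropping to w into the
indicator that the labels have standardization w. *)
Lemma shuffleE s (w : 'S_n) :
  (shuffle a theta w)%:E =
  P (labels_at s @^-1` [set c | standardization [:: c] = w]).
Proof.
pose A := [set c : {ffun 'I_n -> nat} | standardization [:: c] = w].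
pose D b := drop_prob R n (Defs.cut b) [::] [seq w j | j <- enum 'I_n].
have finA : P (labels_at s @^-1` A) \is a fin_num.
  apply: fin_num_measure; apply: measurable_countably_valued.
  exact: measurable_labels_at.
(* The drop probability is an average over the rearrangements of b. *)
have orbit_sum b : ((labels_mass b * D b)%:E =
    \sum_(u : 'S_n) (n`!%:R^-1)%:E *
      (labels_mass b * (permute_cards u b \in A)%:R)%:E)%E.
  rewrite -(mulKf (_ : n`!%:R != 0 :> R) (D b)) ?pnatr_eq0 -?lt0n ?fact_gt0//.
  rewrite /D -card_standardization -sum1_card natr_sum big_mkcond/=.
  under [RHS]eq_bigr do rewrite -EFinM.
  rewrite sumEFin mulrCA !mulr_sumr; congr EFin; apply: eq_bigr => u _.
  congr (_ * (_ * _)); rewrite inE; have -> : (permute_cards u b \in A) =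
      (standardization [:: permute_cards u b] == w).
    by apply/idP/eqP => [/set_mem|?]//; exact/mem_set.
  by case: ifP.
rewrite /shuffle (_ : esum _ _ = P (labels_at s @^-1` A)) ?fineK//.
transitivity (\esum_(b in [set: {ffun 'I_n -> nat}]) (labels_mass b * D b)%:E)%E.
  rewrite esum_mkcond; apply: eq_esum => b _.
  case: ifPn => [/set_mem ab|/negP ab].
    congr (_ * _)%:E; apply: eq_bigr => j _.
    by rewrite /label_mass mem_set//; exact: ab.
  suff -> : labels_mass b = 0 by rewrite mul0r.
  apply/eqP/prodf_eq0; have [j aj] : exists j, ~ labels a (b j).
    by apply/existsNP => al; apply: ab; exact/mem_set.
  by exists j => //; rewrite /label_mass memNset.
under eq_esum do rewrite orbit_sum.
have fact_inv_ge0 : 0 <= (n`!%:R : R)^-1 by rewrite invr_ge0 ler0n.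
have mass_ge0 u b : (0 <= (labels_mass b * (permute_cards u b \in A)%:R)%:E)%E.
  by rewrite lee_fin mulr_ge0 ?ler0n ?labels_mass_ge0.
rewrite esum_sum => [|b u _ _]; last by rewrite mule_ge0// lee_fin.
transitivity (\sum_(u : 'S_n) (n`!%:R^-1)%:E * P (labels_at s @^-1` A))%E.
  apply: eq_bigr => u _; rewrite ge0_esumZl//; congr (_ * _)%E.
  rewrite -(labels_at_exchangeable s u) probability_fibersT; last first.
    exact: measurable_labels_at.
  rewrite [RHS]esum_mkcond; apply: eq_esum => b _.
  rewrite -[b \in _ @^-1` A]/(permute_cards u b \in A).
  by case: ifP => _; rewrite ?mulr1 ?mulr0 ?labels_at_law.
rewrite -(fineK finA); under eq_bigr do rewrite -EFinM.
by rewrite sumEFin sumr_const card_Sn -[X in X%:E = _]mulr_natl mulVKf//.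
Qed.

End LabelProcess.

(** * Pairwise distinct label vectors *)

Definition separated n (h : seq {ffun 'I_n -> nat}) :=
  injective (fun i : 'I_n => [seq (c : {ffun 'I_n -> nat}) i | c <- h]).

Lemma lexlt_tie n (h : seq {ffun 'I_n -> nat}) i j :
  [seq (c : {ffun 'I_n -> nat}) i | c <- h] =
  [seq (c : {ffun 'I_n -> nat}) j | c <- h] ->
  lexlt h i j = (i < j)%N.
Proof.
by elim: h => //= c h IHh [cE /IHh ->]; rewrite cE ltnn eqxx.
Qed.

Lemma lexlt_permute_cards n (h : seq {ffun 'I_n -> nat}) (u : 'S_n) i j :
  [seq (c : {ffun 'I_n -> nat}) (u i) | c <- h] <>
  [seq (c : {ffun 'I_n -> nat}) (u j) | c <- h] ->
  lexlt (map (permute_cards u) h) i j = lexlt h (u i) (u j).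
Proof.
elim: h => //= c h IHh neq; rewrite !ffunE; case: ltngtP => //= cE.
by apply: IHh => hE; apply: neq; rewrite cE hE.
Qed.

Lemma standardization_permute_cards n (h : seq {ffun 'I_n -> nat}) (u : 'S_n) :
  separated h ->
  standardization (map (permute_cards u) h) = (u * standardization h)%g.
Proof.
move=> sep_h; apply/standardizationP => i j; rewrite !permM standardizationE.
have [->|ij] := eqVneq i j; first by rewrite !lexlt_irr.
by rewrite lexlt_permute_cards// => /sep_h/perm_inj/eqP; exact/negP.
Qed.

Lemma separated_permute_cards n (h : seq {ffun 'I_n -> nat}) (u : 'S_n) :
  separated (map (permute_cards u) h) <-> separated h.
Proof.
have mapE i : [seq (c : {ffun 'I_n -> nat}) i | c <- map (permute_cards u) h] =
    [seq (c : {ffun 'I_n -> nat}) (u i) | c <- h].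
  by rewrite -map_comp; apply: eq_map => c /=; rewrite ffunE.
split=> sep_h i j /=; last by rewrite !mapE => /sep_h/perm_inj.
move=> hij; rewrite -[i](permKV u) -[j](permKV u); congr (u _).
by apply: sep_h; rewrite !mapE !permKV.
Qed.

Definition reversal n : 'S_n := perm (@rev_ord_inj n).

(** Two cards with equal vectors keep their order in the standardization, while
the reversal exchanges the order of any two cards. *)
Lemma reversal_separated n (h : seq {ffun 'I_n -> nat}) :
  standardization h = reversal n -> separated h.
Proof.
move/standardizationP => revE i j /= hij; apply: val_inj => /=.
have le (k l : 'I_n) : (k < l)%N -> (reversal n k < reversal n l)%N = false.
  move=> kl; rewrite !permE/=; apply/negbTE; rewrite -leqNgt.
  by apply: leq_sub2l; rewrite ltnS ltnW.
case: (ltngtP i j) => // ij.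
  by have := revE i j; rewrite lexlt_tie// ij le.
by have := revE j i; rewrite lexlt_tie// ij le.
Qed.

(** Vectors that are distinct at some time stay distinct later, so the first
such time exceeds k exactly when they are not distinct at time k. *)
Lemma first_distinct_gt (R : realType) n (L : 'I_n -> nat -> nat) k :
  (k%:R%:E < first_distinct R L)%E <->
  ~ injective (fun i : 'I_n => mkseq (L i) k).
Proof.
split=> [klt injk|ninj].
  by move: klt; rewrite ltNge => /negP; apply; apply: ereal_inf_lbound; exists k.
apply: (@lt_le_trans _ _ k.+1%:R%:E); first by rewrite lte_fin ltr_nat.
apply: le_ereal_inf_tmp => _ [t injt <-]; rewrite lee_fin ler_nat ltnNge.
apply/negP => tk; apply: ninj => i j ij; apply: injt.
have takeE l : mkseq (L l) t = take t (mkseq (L l) k).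
  by rewrite /mkseq -map_take take_iota (minn_idPl tk).
by rewrite !takeE ij.
Qed.

(** * Convolution powers and separation distance *)

Section Separation.
Variables (R : realType) (n : nat) (a : option nat) (theta : nat -> R).
Hypothesis theta_distr : is_distribution a theta.
Variables (d : measure_display) (Omega : measurableType d).
Variables (P : probability Omega R) (X : 'I_n * nat -> {RV P >-> nat}).
Hypothesis X_indep : mutually_independent X.
Hypothesis X_law : forall (i : 'I_n) (s l : nat), labels a l ->
  P [set omega | X (i, s) omega = l] = (theta l)%:E.

Local Notation H := (history X).
Local Notation Y := (labels_at X).

(** The event is split according to the standardization u of the earlier labels.
Given u, the new labels, read along u^-1, are again independent with law theta,
so that they contribute the shuffle probability of u^-1 * w. *)
Lemma convpowE k w :
  (convpow (@shuffle R n a theta) k w)%:E =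
  P (H k @^-1` [set h | standardization h = w]).
Proof.
elim: k w => [|k IHk] w /=.
  rewrite (_ : _ @^-1` _ = [set _ | (w == 1%g)]).
    case: (w == 1%g).
      by rewrite (_ : [set _ | _] = setT) ?probability_setT//; apply/seteqP; split.
    by rewrite (_ : [set _ | _] = set0) ?measure0//; apply/seteqP; split.
  have <- : standardization [::] = 1%g :> 'S_n.
    by apply/standardizationP => i j; rewrite !perm1.
  by apply/seteqP; split=> _ /=; [move=> ->|move/eqP].
pose S (u : 'S_n) := H k @^-1` [set h | standardization h = u].
pose T (u : 'S_n) := Y k @^-1` (permute_cards u^-1%g @^-1`
  [set c | standardization [:: c] = (u^-1 * w)%g]).
transitivity (\sum_(u : 'S_n) P (S u `&` T u))%E; last first.
  pose F := @standardization n \o H k.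
  have mF u : measurable (F @^-1` [set u]).
    exact: (measurable_countably_valued (@measurable_history _ _ _ _ _ X k)
      [set h | standardization h = u]).
  rewrite -[X in _ = P X]setTI -(preimage_setT F) probability_fibers//; last first.
    exact: (measurable_countably_valued (@measurable_history _ _ _ _ _ X k.+1)
      [set h | standardization h = w]).
  rewrite esum_finType//; apply: eq_bigr => u _; congr (P _).
  apply/seteqP; split=> om [Su]; have {}Su : standardization (H k om) = u := Su.
    by move=> TE; split=> //=; rewrite standardization_cons Su TE mulKVg.
  rewrite /= standardization_cons Su => TE; split=> //.
  by rewrite /T/= -TE mulKg.
rewrite -sumEFin.
rewrite (reindex_inj (h := fun u : 'S_n => (u^-1 * w)%g)); last first.
  by move=> u v /= /mulIg/invg_inj.
apply: eq_bigr => u _; rewrite EFinM invMg invgK mulKVg.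
rewrite (history_labels_indep theta_distr X_indep X_law).
rewrite (labels_at_exchangeable theta_distr X_indep X_law).
by rewrite IHk (shuffleE theta_distr X_indep X_law k) muleC.
Qed.

Lemma measurable_history_event k (A : set (seq {ffun 'I_n -> nat})) :
  measurable (H k @^-1` A).
Proof. by apply: measurable_countably_valued => h; exact: measurable_history. Qed.

(** Without ties, permuting the cards by u multiplies the standardization by u
on the left, and this acts transitively on the permutations. *)
Lemma separated_uniform k w :
  P (H k @^-1` [set h | separated h]) =
  (n`!%:R%:E *
   P (H k @^-1` [set h | separated h /\ standardization h = w]))%E.
Proof.
pose p v := P (H k @^-1` [set h | separated h /\ standardization h = v]).
have p_const u v : p (u * v)%g = p v.
  rewrite /p -(history_exchangeable theta_distr X_indep X_law k u); congr (P _).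
  have sepE om := separated_permute_cards (H k om) u.
  apply/seteqP; split=> om /= [/sepE sep_h].
    by rewrite standardization_permute_cards// => /mulgI.
  move=> stdE; split=> //.
  by rewrite standardization_permute_cards ?stdE//; exact/sepE.
have finp : p w \is a fin_num by exact/fin_num_measure/measurable_history_event.
transitivity (\sum_(v : 'S_n) p v)%E.
  pose F := @standardization n \o H k.
  have mF u : measurable (F @^-1` [set u]).
    exact: (measurable_history_event k [set h | standardization h = u]).
  rewrite -[X in P X]setTI -(preimage_setT F) probability_fibers//; last first.
    exact: measurable_history_event.
  rewrite esum_finType//; apply: eq_bigr => v _; congr (P _).
  by apply/seteqP; split=> om [].
have p_w v : p v = (fine (p w))%:E by rewrite fineK// -[v](mulgKV w) p_const.
under eq_bigr do rewrite p_w.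
by rewrite -/(p w) -(fineK finp) sumEFin sumr_const card_Sn -EFinM mulr_natl.
Qed.

Lemma map_history k om i :
  [seq (c : {ffun 'I_n -> nat}) i | c <- H k om] =
  rev (mkseq (fun s => X (i, s) om) k).
Proof. by elim: k => //= k ->; rewrite ffunE mkseqS rev_rcons. Qed.

Lemma separated_history k om :
  separated (H k om) <->
  injective (fun i : 'I_n => mkseq (fun s => X (i, s) om) k).
Proof.
split=> inj i j /=.
  by move=> ij; apply: inj; rewrite /= !map_history ij.
by rewrite !map_history => /(can_inj revK)/inj.
Qed.

Lemma sep_convpow k :
  (sep (convpow (@shuffle R n a theta) k))%:E =
  (1 - P (H k @^-1` [set h | separated h]))%E.
Proof.
set Q := convpow _ _; set D := P _.
have finD : D \is a fin_num by exact/fin_num_measure/measurable_history_event.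
have Q_ge w : fine D <= n`!%:R * Q w.
  rewrite -lee_fin fineK// EFinM convpowE /D (separated_uniform k w).
  apply: lee_pmul => //; apply: le_measure; rewrite ?inE.
  - exact: measurable_history_event.
  - exact: measurable_history_event.
  - by move=> om [].
have Q_rev : n`!%:R * Q (reversal n) = fine D.
  apply: EFin_inj; rewrite fineK// EFinM convpowE /D (separated_uniform k (reversal n)).
  congr (_ * P _)%E; apply/seteqP; split=> om /=; last by case.
  by move=> stdE; split=> //; exact: reversal_separated stdE.
(* The maximum defining sep is attained at the reversal. *)
suff -> : sep Q = 1 - fine D by rewrite EFinB fineK.
apply/eqP; rewrite eq_le; apply/andP; split.
  by apply: bigmax_le => [|w _]; rewrite lerD2l lerN2.
by rewrite -Q_rev; exact: (le_bigmax _ (fun w => 1 - n`!%:R * Q w)).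
Qed.

End Separation.

Unset Implicit Arguments.

Theorem mainTheorem3 (R : realType) (n : nat) (n_ge1 : (1 <= n)%N)
    (a : option nat) (a_ge1 : if a is Some m then (1 <= m)%N else true)
    (theta : nat -> R) (theta_distr : is_distribution a theta)
    (d : measure_display) (Omega : measurableType d) (P : probability Omega R)
    (X : 'I_n * nat -> {RV P >-> nat})
    (X_indep : mutually_independent X)
    (X_law : forall (i : 'I_n) (s l : nat), labels a l ->
       P [set omega | X (i, s) omega = l] = (theta l)%:E)
    (k : nat) :
  (sep (convpow (@shuffle R n a theta) k))%:E =
  P [set omega |
      (k%:R%:E < first_distinct R (fun i s => X (i, s) omega))%E].
Proof.
rewrite (sep_convpow theta_distr X_indep X_law) -probability_setC; last first.
  exact: measurable_history_event.
congr (P _); apply/seteqP; split=> om /=.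
  by move=> nsep; apply/first_distinct_gt => inj; exact/nsep/separated_history.
by move=> /first_distinct_gt ninj /separated_history.
Qed.
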